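(* Let $k,t,r,s$ be integers with $2 \leq k \leq 10$, $2 \leq t \leq 10$, and $1 \leq r < s \leq t$. Then: (1) The weak inequality $D_k(r,t;n) \geq D_k(s,t;n)$ holds for all $n \geq 1$ if $k\geq 3$, and for all $n \geq 9$ if $k = 2$. (2) The strict inequality $D_k(r,t;n) > D_k(s,t;n)$ holds for all $n \geq 17$.
   Context: A partition of $n$ is a nonincreasing sequence $\lambda=(\lambda_1,\dots,\lambda_\ell)$ of positive integers (its parts) with sum $n$. A partition is $k$-regular if every part occurs with multiplicity less than $k$. For integers $k,t\ge 2$, $1\le r\le t$, $D_k(r,t;n)$ is the total number of parts congruent to $r$ modulo $t$ among all $k$-regular partitions of $n$, counted with multiplicity: $D_k(r,t;n) := \sum_{\lambda} \#\{j : \lambda_j \equiv r \pmod t\}$, the sum running over all $k$-regular partitions $\lambda$ of $n$. *)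

(* Defs.v *)
From mathcomp Require Import all_boot.

Set Implicit Arguments.
Unset Strict Implicit.
Unset Printing Implicit Defensive.

Definition is_partition (n : nat) (l : seq nat) : bool :=
  [&& sorted geq l, all (leq 1) l & sumn l == n].

Definition regular (k : nat) (l : seq nat) : bool :=
  all (fun x => count_mem x l < k) l.

Definition parts_mod (r t : nat) (l : seq nat) : nat :=
  count (fun x => x == r %[mod t]) l.

Definition bseq_nat (m b : nat) (l : {bseq m of 'I_b}) : seq nat :=
  [seq val i | i <- l].

(* A partition of n has at most n parts, each at most n, so every partition of n
   is bseq_nat l for exactly one l : {bseq n of 'I_n.+1}; see bseq_nat_inj and
   partition_bseq below. *)
Definition D (k r t n : nat) : nat :=
  \sum_(l : {bseq n of 'I_n.+1}
         | is_partition n (bseq_nat l) && regular k (bseq_nat l))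
     parts_mod r t (bseq_nat l).

Lemma bseq_nat_inj (m b : nat) : injective (@bseq_nat m b).
Proof. by move=> l1 l2 /(inj_map val_inj) /val_inj. Qed.

Lemma partition_bseq (n : nat) (p : seq nat) :
  is_partition n p -> exists l : {bseq n of 'I_n.+1}, bseq_nat l = p.
Proof.
case/and3P=> _ pos /eqP sum_p.
have size_p : size p <= n.
  rewrite -sum_p; elim: p pos {sum_p} => //= x p IH /andP[x0 /IH le_p].
  by rewrite -add1n leq_add.
have le_p : all (fun x => x < n.+1) p.
  apply/allP=> x xp; rewrite ltnS -sum_p.
  elim: p xp {pos sum_p size_p} => //= y p IH; rewrite inE.
  by case/predU1P=> [->|/IH le_x]; rewrite ?leq_addr // (leq_trans le_x) ?leq_addl.
have eq_p : map val [seq inord x : 'I_n.+1 | x <- p] = p.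
  rewrite -map_comp -[RHS]map_id; apply/eq_in_map=> x xp /=.
  by rewrite inordK // (allP le_p).
have sz : size [seq inord x : 'I_n.+1 | x <- p] <= n by rewrite size_map.
by exists (Bseq sz).
Qed.

(* Main.v *)
From Stdlib Require Import ZArith.
Require Import Defs.
From mathcomp Require Import all_boot all_order all_algebra.
From mathcomp Require Import ssrZ zify ring.

Set Implicit Arguments.
Unset Strict Implicit.
Unset Printing Implicit Defensive.
Import Order.TTheory GRing.Theory Num.Theory.

(** Let E_m(n) be the total multiplicity of the part m in the k-regular
    partitions of n, so that D_k(r,t;n) is the sum of E_m(n) over m = r (mod t).
    It is enough to compare E_m(n) with E_(m+1)(n). Put S_j = sum_(a<k) q^(aj).
    Exchanging the multiplicities of m and m+1 shows that
      sum_n (E_m(n) - E_(m+1)(n)) q^n = (1-q) P W,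
    where P is the product of the S_j over j <> m, m+1, and
    W = sum_(b<a<k) (a-b) q^((a+b)m+b) (1 + q + ... + q^(a-b-1)).

    For m >= 10, (1-q) P has nonnegative coefficients, because
    (1-q^u) S_u S_(uk) S_(uk^2) ... = 1: with u = 1 this proves it at once unless m
    or m+1 is a power K of k. In that case the telescoping stops at 1-q^K, and
    1-q^K is absorbed by the chains of two small numbers u, v not divisible by k,
    since K = ua + vb.

    For m <= 9, adding 1 to the largest part of a partition shows that (1-q) P
    dominates (1-q+q^(m+2)) S_1...S_(m-1), up to explicit nonnegative terms which are
    positive in large degree. The product of this polynomial with W is computed. *)

(** * From partitions to generating functions *)

(** The value [f j] is the multiplicity of the part [j.+1]; the codomain ['I_k] encodes
    regularity. *)
Definition parts_of n k (f : {ffun 'I_n -> 'I_k}) : seq nat :=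
  sort geq (flatten [seq nseq (f j) j.+1 | j <- enum 'I_n]).

Definition weight n k (f : {ffun 'I_n -> 'I_k}) : nat := \sum_j f j * j.+1.

Lemma count_parts_of n k (f : {ffun 'I_n -> 'I_k}) (p : pred nat) :
  count p (parts_of f) = \sum_(j : 'I_n | p j.+1) f j.
Proof.
rewrite /parts_of count_sort count_flatten sumnE 2!big_map big_enum /=.
rewrite [RHS]big_mkcond; apply: eq_bigr => j _.
by rewrite count_nseq; case: (p _); rewrite ?mul1n.
Qed.

Lemma sumn_parts_of n k (f : {ffun 'I_n -> 'I_k}) :
  sumn (parts_of f) = weight f.
Proof.
rewrite /parts_of (perm_sumn (permEl (perm_sort _ _))) sumn_flatten sumnE.
rewrite 2!big_map big_enum /=; apply: eq_bigr => j _.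
by rewrite sumn_nseq mulnC.
Qed.

Lemma mem_parts_of n k (f : {ffun 'I_n -> 'I_k}) x :
  x \in parts_of f -> 0 < x <= n.
Proof.
rewrite mem_sort => /flattenP[s /mapP[j _ ->]].
by rewrite mem_nseq => /andP[_ /eqP->] /=.
Qed.

Lemma count_mem_parts_of n k (f : {ffun 'I_n -> 'I_k}) (j : 'I_n) :
  count_mem j.+1 (parts_of f) = f j.
Proof.
by rewrite count_parts_of (big_pred1 j).
Qed.

Lemma sorted_geq_inj (s1 s2 : seq nat) :
  sorted geq s1 -> sorted geq s2 -> perm_eq s1 s2 -> s1 = s2.
Proof.
apply: sorted_eq => [y x z /= xy yz|x y /= /andP[xy yx]].
  exact: leq_trans yz xy.
by apply/eqP; rewrite eqn_leq yx xy.
Qed.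

Lemma is_partition_parts_of n k (f : {ffun 'I_n -> 'I_k}) :
  weight f = n ->
  is_partition n (parts_of f) && regular k (parts_of f).
Proof.
move=> wf; apply/andP; split.
  apply/and3P; split.
  - by apply: sort_sorted => x y; exact: leq_total.
  - by apply/allP => x /mem_parts_of/andP[].
  - by rewrite sumn_parts_of wf.
apply/allP => x /mem_parts_of/andP[x0 xn].
have xn' : x.-1 < n by rewrite prednK.
by have := count_mem_parts_of f (Ordinal xn'); rewrite /= prednK // => ->.
Qed.

Lemma size_leq_sumn (s : seq nat) : all (leq 1) s -> size s <= sumn s.
Proof. by elim: s => //= x s IH /andP[x0 /IH]; rewrite -add1n; apply: leq_add. Qed.

Lemma leq_sumn (s : seq nat) x : x \in s -> x <= sumn s.
Proof.
elim: s => //= y s IH; rewrite inE => /predU1P[->|/IH le_xs].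
  exact: leq_addr.
by apply: leq_trans le_xs _; apply: leq_addl.
Qed.

Definition ffun_of_parts n k (s : seq nat) : {ffun 'I_n -> 'I_k.+1} :=
  [ffun j : 'I_n => inord (count_mem j.+1 s)].

Lemma parts_of_ffun_of_parts n k (s : seq nat) :
  is_partition n s -> regular k.+1 s -> parts_of (ffun_of_parts n k s) = s.
Proof.
case/and3P=> srt pos /eqP sum_s reg; apply: sorted_geq_inj => //.
  by apply: sort_sorted => x y; exact: leq_total.
apply/allP => x _ /=.
have lt_count j : count_mem j s < k.+1.
  have [js|js] := boolP (j \in s); first exact: (allP reg).
  by rewrite (count_memPn js).
case: (boolP (0 < x <= n)) => [/andP[x0 xn]|x_out].
  have xn' : x.-1 < n by rewrite prednK.
  have := count_mem_parts_of (ffun_of_parts n k s) (Ordinal xn').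
  by rewrite /= prednK // => ->; rewrite ffunE inordK /= ?prednK.
rewrite !(count_memPn _) //; apply: contra x_out; last exact: mem_parts_of.
by move=> xs; rewrite (allP pos) // -sum_s leq_sumn.
Qed.

Lemma D_sum_ffun k r t n :
  D k.+1 r t n =
  \sum_(f : {ffun 'I_n -> 'I_k.+1} | weight f == n)
    \sum_(j : 'I_n | j.+1 == r %[mod t]) f j.
Proof.
(* The defaults of [insub_bseq] and [inord] matter only for [f] of weight other than [n]. The
   condition [h' (h f) = f] excludes these, since [h'] sends regular partitions of [n] to functions
   of weight [n]. *)
pose h (f : {ffun 'I_n -> 'I_k.+1}) : {bseq n of 'I_n.+1} :=
  insub_bseq n [seq inord x | x <- parts_of f].
pose h' (l : {bseq n of 'I_n.+1}) := ffun_of_parts n k (bseq_nat l).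
have hK (f : {ffun 'I_n -> 'I_k.+1}) : weight f = n -> bseq_nat (h f) = parts_of f.
  move=> wf; have /andP[/and3P[_ pos /eqP sum_f] _] := is_partition_parts_of wf.
  have le_n : size (parts_of f) <= n by rewrite -[leqRHS]sum_f size_leq_sumn.
  rewrite /bseq_nat /h /insub_bseq insubdK; last by rewrite -topredE /= size_map.
  rewrite -map_comp map_id_in // => x /mem_parts_of/andP[_ xn] /=.
  by rewrite inordK.
have part_h' l : is_partition n (bseq_nat l) && regular k.+1 (bseq_nat l) ->
    parts_of (h' l) = bseq_nat l /\ weight (h' l) = n.
  case/andP=> pl rl; have e := parts_of_ffun_of_parts pl rl; split=> //.
  by rewrite -sumn_parts_of e; case/and3P: pl => _ _ /eqP.
rewrite /D (reindex_onto h h') => [|l /part_h'[e w]]; last first.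
  by apply: bseq_nat_inj; rewrite hK.
apply: eq_big => [f|f /andP[/part_h'[_ w] /eqP e]]; last first.
  rewrite e in w; rewrite /parts_mod hK // count_parts_of.
  exact: eq_bigl.
apply/andP/eqP => [[/part_h'[_ w] /eqP e]|w]; first by rewrite e in w.
rewrite hK // is_partition_parts_of //; split=> //; apply/eqP/ffunP => j.
by rewrite ffunE hK // count_mem_parts_of inord_val.
Qed.

Local Open Scope ring_scope.

Definition geom (R : nzRingType) (k j : nat) : {poly R} := \sum_(a < k) 'X^(a * j).

Definition dgeom (R : nzRingType) (k j : nat) : {poly R} :=
  \sum_(a < k) 'X^(a * j) *+ a.

(* Generating function of the k-regular partitions with parts at most n in P. *)
Definition genparts (R : comNzRingType) (k : nat) (P : pred nat) (n : nat) :
    {poly R} :=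
  \prod_(1 <= i < n.+1 | P i) geom R k i.

(* E_m(n); parts larger than n do not affect the coefficient of q^n. *)
Definition mult_coef (R : comNzRingType) (k n m : nat) : R :=
  (dgeom R k m * genparts R k (predC1 m) n)`_n.

(** Expanding the product of sums chooses one multiplicity per part, that is a function [f]; the
    factor of the part [j.+1] contributes the weight [f j]. *)
Lemma sum_ffun_coef (R : comNzRingType) k n (j : 'I_n) :
  (\sum_(f : {ffun 'I_n -> 'I_k} | weight f == n) f j)%N%:R =
  mult_coef R k n j.+1.
Proof.
rewrite /mult_coef.
have -> : dgeom R k j.+1 * genparts R k (predC1 j.+1) n =
    \prod_(i < n) \sum_(a < k) 'X^(a * i.+1) *+ (if i == j then a : nat else 1%N).
  rewrite [RHS](bigD1 j) //= eqxx; congr (_ * _).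
  rewrite /genparts big_add1 /= big_mkord; apply: eq_big => [i|i].
    by rewrite eqSS.
  move/negPf; rewrite /= eqSS val_eqE => nij; rewrite nij /geom.
  by apply: eq_bigr => a _; rewrite mulr1n.
rewrite bigA_distr_bigA coef_sum natr_sum big_mkcond /=.
apply: eq_bigr => f _; rewrite prodrMn coefMn.
rewrite -expr_sum coefXn eq_sym -big_mkcond big_pred1_eq /weight.
by case: eqP; rewrite ?mul0rn.
Qed.

Lemma D_mult_coef (R : comNzRingType) k r t n :
  (D k.+1 r t n)%:R =
  \sum_(1 <= m < n.+1 | (m == r %[mod t])%N) mult_coef R k.+1 n m.
Proof.
rewrite D_sum_ffun exchange_big /= natr_sum big_add1 /= big_mkord.
by apply: eq_bigr => j _; rewrite sum_ffun_coef.
Qed.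

(** * Chains of parts *)

Local Notation nneg := (@Num.Def.nneg_num_pred _).

(** The cutoff lets a factor 1 - q^j with j > n, left at the end of a chain, count as
    nonnegative. *)
Definition coef_ge0 (R : numDomainType) (n : nat) (p : {poly R}) : Prop :=
  forall i, (i <= n)%N -> 0 <= p`_i.

Lemma coef_ge0D (R : numDomainType) n (p q : {poly R}) :
  coef_ge0 n p -> coef_ge0 n q -> coef_ge0 n (p + q).
Proof. by move=> p0 q0 i le_in; rewrite coefD addr_ge0 ?p0 ?q0. Qed.

Lemma coef_ge0M (R : numDomainType) n (p q : {poly R}) :
  coef_ge0 n p -> coef_ge0 n q -> coef_ge0 n (p * q).
Proof.
move=> p0 q0 i le_in; rewrite coefM sumr_ge0 // => j _.
have le_ji : (j <= i)%N by rewrite -ltnS.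
rewrite mulr_ge0 ?p0 ?q0 //; first exact: leq_trans le_ji le_in.
by apply: leq_trans le_in; apply: leq_subr.
Qed.

Lemma nneg_coef_ge0 (R : numDomainType) n (p : {poly R}) :
  p \is a polyOver nneg -> coef_ge0 n p.
Proof. by move=> /polyOverP p0 i _; have := p0 i. Qed.

Lemma coef_ge0_subXn (R : numDomainType) n m :
  (n < m)%N -> coef_ge0 n (1 - 'X^m : {poly R}).
Proof.
move=> lt_nm i le_in; rewrite coefB coef1 coefXn.
by rewrite (ltn_eqF (leq_ltn_trans le_in lt_nm)) subr0 ler0n.
Qed.

Lemma geom_nneg (R : numDomainType) k j : geom R k j \is a polyOver nneg.
Proof. by apply: rpred_sum => a _; apply: polyOverXn. Qed.

Lemma dgeom_nneg (R : numDomainType) k j : dgeom R k j \is a polyOver nneg.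
Proof. by apply: rpred_sum => a _; rewrite rpredMn ?polyOverXn. Qed.

Lemma genparts_nneg (R : numDomainType) k P n :
  genparts R k P n \is a polyOver nneg.
Proof. by apply: rpred_prod => i _; apply: geom_nneg. Qed.

Lemma one_sub_geom (R : comNzRingType) k j :
  (1 - 'X^j) * geom R k j = 1 - 'X^(j * k).
Proof.
rewrite exprM -[RHS]opprB subrX1 -mulNr opprB; congr (_ * _).
by apply: eq_bigr => a _; rewrite -exprM mulnC.
Qed.

Lemma eq_genparts (R : comNzRingType) k (P Q : pred nat) n :
  {in [pred i | 0 < i <= n]%N, P =1 Q} -> genparts R k P n = genparts R k Q n.
Proof.
move=> eqPQ; rewrite /genparts big_nat_cond [RHS]big_nat_cond.
by apply: eq_bigl => i; case: (boolP (1 <= i < n.+1)%N) => //= /eqPQ.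
Qed.

Lemma genpartsD1 (R : comNzRingType) k (P : pred nat) n u :
  (0 < u <= n)%N -> P u ->
  genparts R k P n = geom R k u * genparts R k (fun i => (i != u) && P i) n.
Proof.
move=> un Pu; rewrite /genparts big_mkcond (bigD1_seq u) /= ?iota_uniq //.
  by rewrite Pu -big_mkcondr.
by rewrite mem_index_iota.
Qed.

Lemma genpartsS (R : comNzRingType) k (P : pred nat) n :
  genparts R k P n.+1 =
  genparts R k P n * (if P n.+1 then geom R k n.+1 else 1).
Proof. by rewrite /genparts big_mkcond big_nat_recr //= -big_mkcond. Qed.

(* (1 - q^u) S_u = 1 - q^(uk), so the factors along u, uk, uk^2, ... telescope. *)
Lemma chain_coef_ge0 (R : numDomainType) k n u e (P : pred nat) :
  (1 < k)%N -> (0 < u)%N -> (forall i, (i < e)%N -> P (u * k ^ i)%N) ->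
  coef_ge0 n ((1 - 'X^(u * k ^ e)) *
    genparts R k (fun i => P i && (i \notin [seq (u * k ^ j)%N | j <- iota 0 e])) n) ->
  coef_ge0 n ((1 - 'X^u) * genparts R k P n).
Proof.
move=> k1; elim: e u P => [|e IH] u P u0 Pch.
  by rewrite expn0 muln1 (@eq_genparts _ _ _ P) // => i _; rewrite /= andbT.
move=> ge0; have [un|nu] := leqP u n; last first.
  apply: coef_ge0M; first exact: coef_ge0_subXn.
  exact/nneg_coef_ge0/genparts_nneg.
have Pu : P u by have := Pch 0%N isT; rewrite expn0 muln1.
rewrite (@genpartsD1 _ _ _ _ u) ?u0 // mulrA one_sub_geom.
have lt_uk : (u < u * k)%N by rewrite -[ltnLHS]muln1 ltn_pmul2l.
apply: IH => [|i ie|]; first by rewrite muln_gt0 u0 ltnW.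
  rewrite -mulnA -expnS Pch // andbT -[X in _ != X]muln1 eqn_pmul2l //.
  by rewrite expnS muln_eq1; apply/nandP; left; rewrite gtn_eqF.
move: ge0; rewrite -mulnA -expnS => ge0.
rewrite (@eq_genparts _ _ _
  (fun i => P i && (i \notin [seq (u * k ^ j)%N | j <- iota 0 e.+1]))) //.
move=> i _ /=; rewrite inE expn0 muln1 negb_or andbA [in RHS]andbC [P i && _]andbC.
rewrite [in LHS]andbC; congr (~~ (i \in _) && _).
rewrite (iotaDl 1 0) -map_comp; apply: eq_map => j /=.
by rewrite -mulnA -expnS.
Qed.

Lemma full_chain_coef_ge0 (R : numDomainType) k n u (P : pred nat) :
  (1 < k)%N -> (0 < u)%N -> (forall i, P (u * k ^ i)%N) ->
  coef_ge0 n ((1 - 'X^u) * genparts R k P n).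
Proof.
(* After [n] links the remaining factor is 1 - q^(u k^n), and u k^n > n. *)
move=> k1 u0 Pch; apply: (@chain_coef_ge0 _ _ _ _ n) => //.
apply: coef_ge0M; last exact/nneg_coef_ge0/genparts_nneg.
apply: coef_ge0_subXn; apply: leq_trans (ltn_expl n k1) _.
exact: leq_pmull.
Qed.

Lemma coef_ge0_subXnM (R : numDomainType) n u a (p : {poly R}) :
  coef_ge0 n ((1 - 'X^u) * p) -> coef_ge0 n ((1 - 'X^(u * a)) * p).
Proof.
move=> ge0; rewrite -(one_sub_geom R a u) mulrAC.
by apply: coef_ge0M => //; exact/nneg_coef_ge0/geom_nneg.
Qed.

Lemma coef_ge0_subXnD (R : numDomainType) n i j (p : {poly R}) :
  coef_ge0 n ((1 - 'X^i) * p) -> coef_ge0 n ((1 - 'X^j) * p) ->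
  coef_ge0 n ((1 - 'X^(i + j)) * p).
Proof.
move=> gei gej.
have -> : (1 - 'X^(i + j)) * p = (1 - 'X^i) * p + 'X^i * ((1 - 'X^j) * p).
  by rewrite exprD; ring.
apply: coef_ge0D => //; apply: coef_ge0M => //.
exact/nneg_coef_ge0/polyOverXn.
Qed.

(** * Nonnegativity of (1-q) P for m >= 10 *)

Definition off_pair (m : nat) : pred nat := fun i => (i != m) && (i != m.+1).

(** A number strictly between consecutive powers of [k] stays so after multiplication by k^i; hence
    its chain is disjoint from the chain of 1. *)
Lemma expn_between k c u i j :
  (1 < k)%N -> (k ^ c < u < k ^ c.+1)%N -> (u * k ^ i != k ^ j)%N.
Proof.
move=> k1 /andP[cu uc]; apply/eqP => e.
have k0 : (0 < k ^ i)%N by rewrite expn_gt0 ltnW.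
have : (k ^ (c + i) < k ^ j)%N by rewrite -e expnD ltn_pmul2r.
have : (k ^ j < k ^ (c.+1 + i))%N by rewrite -e expnD ltn_pmul2r.
by rewrite !ltn_exp2l // addSn ltnS leqNgt => /negP.
Qed.

(** The pair (u,v) is (2,3) for k >= 4, (3,5) for k = 2 and (2,5) for k = 3. The coefficient [b]
    fixes the residue of [K] modulo [u], and K >= 10 keeps the subtraction in [a] from
    truncating. *)
Lemma two_generators k K :
  (1 < k)%N -> (10 <= K)%N ->
  exists u v a b, [/\ (0 < u <= 5)%N, (0 < v <= 5)%N, K = (u * a + v * b)%N,
    exists c, (k ^ c < u < k ^ c.+1)%N & exists c, (k ^ c < v < k ^ c.+1)%N].
Proof.
move=> k1 K10; have [k4|k3] := ltnP 3 k.
  exists 2, 3, (K./2 - odd K)%N, (odd K : nat).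
  by split=> //; [lia|exists 0; rewrite expn0 expn1; lia|exists 0; rewrite expn0 expn1; lia].
have [->|->] : k = 2 \/ k = 3 by lia.
  exists 3, 5, ((K - 5 * (K * 2 %% 3)) %/ 3)%N, (K * 2 %% 3)%N.
  split=> //; [lia|by exists 1|by exists 2].
exists 2, 5, (K./2 - odd K * 2)%N, (odd K : nat).
by split=> //; [lia|exists 0|exists 1].
Qed.

Lemma genparts_off_pair_ge0 (R : numDomainType) k m n :
  (1 < k)%N -> (10 <= m)%N ->
  coef_ge0 n ((1 - 'X) * genparts R k (off_pair m) n).
Proof.
move=> k1 m10; rewrite -['X]expr1.
case: (boolP [exists e : 'I_m.+2, (k ^ e == m) || (k ^ e == m.+1)]%N); last first.
  move=> /existsPn nopow; apply: full_chain_coef_ge0 => // i; rewrite mul1n.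
  have [lt_im|le_mi] := ltnP i m.+2.
    by have := nopow (Ordinal lt_im); rewrite negb_or.
  by have := ltn_expl i k1; rewrite /off_pair; lia.
case/existsP=> e He.
set K := (k ^ e)%N in He.
have e0 : (0 < e)%N by rewrite lt0n; apply: contraTneq He => e0; rewrite /K e0; lia.
have K10 : (10 <= K)%N by lia.
have dvdK i : (0 < i)%N -> (k %| k ^ i)%N by case: i => // i _; rewrite expnS dvdn_mulr.
(* Consecutive integers are not both divisible by [k], so [K] is the only obstruction for multiples
   of [k]. *)
have ndvd L : (k %| L)%N -> ((L == m) || (L == m.+1))%N -> L = K.
  move=> kL HL; apply/eqP; case: eqP => // nLK.
  have [] : L = K.+1 \/ K = L.+1 by lia.
    by move=> E; move: kL; rewrite E -addn1 dvdn_addr ?dvdK // dvdn1; lia.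
  by move=> E; have := dvdK _ e0; rewrite -/K E -addn1 dvdn_addr // dvdn1; lia.
(* The links 1, k, ..., k^(e-1) are used up, and the factor 1 - q^K remains. *)
apply: (@chain_coef_ge0 _ _ _ _ e) => // [i lt_ie|].
  rewrite mul1n /off_pair -negb_or; apply/negP => Hi.
  have [i0|i0] := posnP i; first by move: Hi; rewrite i0 expn0; lia.
  by have := ndvd _ (dvdK _ i0) Hi; apply/eqP; rewrite neq_ltn ltn_exp2l ?lt_ie.
rewrite mul1n -/K; set P := (fun i => _).
have Pchain u : (0 < u <= 5)%N -> (exists c, (k ^ c < u < k ^ c.+1)%N) ->
    coef_ge0 n ((1 - 'X^u) * genparts R k P n).
  move=> u5 [c kcu]; apply: full_chain_coef_ge0 => // [|i]; first by case/andP: u5.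
  apply/andP; split; last first.
    by apply/mapP => -[j _ /eqP]; rewrite mul1n; apply/negP/(expn_between _ _ _ kcu).
  rewrite /off_pair -negb_or; apply/negP => Hi.
  have [i0|i0] := posnP i; first by move: Hi; rewrite i0 expn0; lia.
  have := ndvd _ (dvdn_mull u (dvdK _ i0)) Hi; apply/eqP.
  exact: expn_between kcu.
have [u [v [a [b [u5 v5 -> uc vc]]]]] := two_generators k1 K10.
by apply: coef_ge0_subXnD; apply: coef_ge0_subXnM; apply: Pchain.
Qed.

(** * Differences of consecutive multiplicities *)

Definition pair_weight (R : comNzRingType) (k m : nat) : {poly R} :=
  \sum_(a < k) \sum_(b < a)
    ('X^((a + b) * m + b) * geom R (a - b) 1) *+ (a - b).

Lemma sum_square_pairs (V : zmodType) (G : nat -> nat -> V) k :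
  \sum_(a < k) \sum_(b < k) G a b =
  \sum_(a < k) (G a a + \sum_(b < a) (G a b + G b a)).
Proof.
elim: k => [|k IH]; first by rewrite !big_ord0.
rewrite [RHS]big_ord_recr [LHS]big_ord_recr /= -IH.
under eq_bigr => a _ do rewrite big_ord_recr /=.
rewrite big_split /= big_ord_recr /= big_split /= -!addrA; congr (_ + _).
by rewrite addrC [X in X + _ = _]addrC -addrA.
Qed.

(** The diagonal cancels, and the multiplicities (a,b) and (b,a) together give (a-b) q^((a+b)m+b) (1
    - q^(a-b)), from which 1 - q splits off. *)
Lemma dgeom_geom_sub (R : comNzRingType) k m :
  dgeom R k m * geom R k m.+1 - geom R k m * dgeom R k m.+1 =
  (1 - 'X) * pair_weight R k m.
Proof.
rewrite /dgeom /geom !big_distrlr /= -sumrB.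
under eq_bigr => a _ do rewrite -sumrB.
rewrite (sum_square_pairs (fun a b => 'X^(a * m) *+ a * 'X^(b * m.+1) -
  'X^(a * m) * ('X^(b * m.+1) *+ b))) /pair_weight big_distrr /=.
apply: eq_bigr => a _; rewrite mulrnAl mulrnAr subrr add0r big_distrr /=.
apply: eq_bigr => b _; rewrite !mulrnAl !mulrnAr -!exprD.
have := one_sub_geom R (a - b) 1; rewrite expr1 mul1n mulrCA => ->.
have leba : (b <= a)%N by apply: ltnW.
have -> : (b * m + a * m.+1 = (a + b) * m + b + (a - b))%N by nia.
have -> : (a * m + b * m.+1 = (a + b) * m + b)%N by nia.
rewrite !exprD mulrBr mulr1 mulrnBr // !mulrnBl.
by move: (_ *+ a) (_ *+ b) (_ *+ a) (_ *+ b) => x y z t; ring.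
Qed.

Lemma pair_weight_nneg (R : numDomainType) k m :
  pair_weight R k m \is a polyOver nneg.
Proof.
apply: rpred_sum => a _; apply: rpred_sum => b _; rewrite rpredMn //.
by rewrite rpredM ?polyOverXn ?geom_nneg.
Qed.

Lemma mult_coefB (R : comNzRingType) k m n :
  (0 < m < n)%N ->
  mult_coef R k n m - mult_coef R k n m.+1 =
  ((1 - 'X) * genparts R k (off_pair m) n * pair_weight R k m)`_n.
Proof.
move=> /andP[m0 mn]; rewrite /mult_coef.
rewrite (@genpartsD1 _ _ (predC1 m) _ m.+1) ?mn //=; last by rewrite gtn_eqF.
rewrite (@genpartsD1 _ _ (predC1 m.+1) _ m) ?m0 ?(ltnW mn) //=; last by rewrite ltn_eqF.
rewrite -coefB; congr ((polyseq _)`_n); rewrite mulrAC -dgeom_geom_sub.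
rewrite (@eq_genparts _ _ (fun i => (i != m) && (i != m.+1)) (off_pair m)) //.
rewrite (@eq_genparts _ _ (fun i => (i != m.+1) && (i != m)) (off_pair m)); last first.
  by move=> i _; rewrite andbC.
ring.
Qed.

Lemma mult_coef_ge0 (R : numDomainType) k n m : 0 <= mult_coef R k n m.
Proof.
have /polyOverP : dgeom R k m * genparts R k (predC1 m) n \is a polyOver nneg.
  by rewrite rpredM ?dgeom_nneg ?genparts_nneg.
exact.
Qed.

Lemma mult_coef_eq0 (R : comNzRingType) k n m :
  (n < m)%N -> mult_coef R k n m = 0.
Proof.
move=> nm; rewrite /mult_coef coefM big1 // => i _.
rewrite /dgeom coef_sum big1 ?mul0r // => a _; rewrite coefMn coefXn.
case: (posnP a) => [->|a0]; first by rewrite mulr0n.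
have lt_im : (i < m)%N by apply: leq_ltn_trans nm; rewrite -ltnS.
by rewrite ltn_eqF ?mul0rn // (leq_trans lt_im) // leq_pmull.
Qed.

(** * Adding 1 to the largest part *)

Definition geom_excess (R : comNzRingType) (k j : nat) : {poly R} :=
  \sum_(2 <= a < k) 'X^(a * j) + 'X^(k * j + 1).

Lemma geom_excess_nneg (R : numDomainType) k j :
  geom_excess R k j \is a polyOver nneg.
Proof.
by rewrite rpredD ?polyOverXn // rpred_sum // => a _; apply: polyOverXn.
Qed.

(* The excess counts the partitions that do not arise by adding 1 to the largest part
   of another one: n+1 repeated 2 to k-1 times, or n+2 above k-1 copies of n+1. The term
   q^(n+1) makes up for the bound on the parts. *)
Lemma largest_part_step (R : comNzRingType) k m n :
  (1 < k)%N -> (m < n)%N ->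
  (1 - 'X + 'X^(n.+2)) * genparts R k (off_pair m) n.+1 =
  (1 - 'X + 'X^(n.+1)) * genparts R k (off_pair m) n +
  genparts R k (off_pair m) n * geom_excess R k n.+1.
Proof.
move=> k1 mn; rewrite genpartsS.
have -> : off_pair m n.+1 by rewrite /off_pair; lia.
have geomE : geom R k n.+1 = 1 + 'X^(n.+1) + \sum_(2 <= a < k) 'X^(a * n.+1).
  rewrite /geom -(big_mkord xpredT (fun a => 'X^(a * n.+1))).
  rewrite big_ltn ?(ltnW k1) // big_ltn // mul0n mul1n expr0.
  by rewrite addrA.
have := one_sub_geom R k n.+1; rewrite mulnC /geom_excess exprD expr1.
rewrite (exprS 'X n.+1); move: geomE.
move: (\sum_(2 <= a < k) _) (geom R k n.+1) (genparts _ _ _ _).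
move: ('X^(n.+1)) ('X^(k * n.+1)) => y yk s g p -> e.
have -> : yk = 1 - (1 - y) * (1 + y + s) by rewrite e; ring.
ring.
Qed.

(** The steps telescope down to the bound [m.+1], where only S_1...S_(m-1) is left of the
    product. *)
Lemma largest_part_sum (R : comNzRingType) k m n :
  (1 < k)%N -> (m < n)%N ->
  (1 - 'X + 'X^(n.+1)) * genparts R k (off_pair m) n =
  (1 - 'X + 'X^(m.+2)) * genparts R k (off_pair m) m.+1 +
  \sum_(m.+1 <= j < n) genparts R k (off_pair m) j * geom_excess R k j.+1.
Proof.
move=> k1; elim: n => // n IH; rewrite ltnS leq_eqVlt => /predU1P[<-|mn].
  by rewrite big_geq // addr0.
by rewrite largest_part_step // IH // big_nat_recr //= addrA.
Qed.

Lemma genparts_below (R : comNzRingType) k m :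
  genparts R k (off_pair m.+1) m.+2 = genparts R k xpredT m.
Proof.
rewrite !genpartsS /off_pair /= !eqxx !andbF /= !mulr1.
by apply: eq_genparts => i; rewrite inE /=; lia.
Qed.

(** * Small parts: evaluation of the certificate *)

(* [{poly Z}] does not compute, coefficient lists do. *)
Fixpoint addl (s t : seq Z) : seq Z :=
  match s, t with
  | [::], _ => t
  | _, [::] => s
  | x :: s', y :: t' => Z.add x y :: addl s' t'
  end.

Fixpoint mull (s t : seq Z) : seq Z :=
  if s is x :: s' then addl [seq Z.mul x y | y <- t] (Z0 :: mull s' t) else [::].

Definition suml := foldr addl [::].
Definition Xnl (n : nat) : seq Z := ncons n Z0 [:: Zpos xH].
Definition geoml (k j : nat) : seq Z := suml [seq Xnl (a * j) | a <- iota 0 k].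
Definition pair_weightl (k m : nat) : seq Z :=
  suml [seq suml [seq mull (Xnl ((a + b) * m + b))
                          [seq Z.mul (Z.of_nat (a - b)) x | x <- geoml (a - b) 1]
                  | b <- iota 0 a] | a <- iota 0 k].
(** Coefficients of (1 - q + q^(m+2)) S_1...S_(m-1) W. *)
Definition certl (k m : nat) : seq Z :=
  mull (addl [:: Zpos xH; Zneg xH] (Xnl m.+2))
    (mull (foldr mull [:: Zpos xH] [seq geoml k i | i <- iota 1 m.-1])
      (pair_weightl k m)).

Lemma Poly_addl s t : Poly (addl s t) = Poly s + Poly t.
Proof.
elim: s t => [|x s IH] [|y t] /=; rewrite ?add0r ?addr0 //.
rewrite !cons_poly_def IH.
have -> : (Z.add x y)%:P = x%:P + y%:P :> {poly Z} by rewrite -polyCD.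
ring.
Qed.

Lemma Poly_scalel c t : Poly [seq Z.mul c y | y <- t] = c%:P * Poly t.
Proof.
elim: t => [|y t IH] /=; first by rewrite mulr0.
rewrite !cons_poly_def IH.
have -> : (Z.mul c y)%:P = c%:P * y%:P :> {poly Z} by rewrite -polyCM.
ring.
Qed.

Lemma Poly_mull s t : Poly (mull s t) = Poly s * Poly t.
Proof.
elim: s => [|x s IH] /=; first by rewrite mul0r.
by rewrite Poly_addl Poly_scalel /= !cons_poly_def IH addr0; ring.
Qed.

Lemma Poly_suml (s : seq (seq Z)) : Poly (suml s) = \sum_(t <- s) Poly t.
Proof. by elim: s => [|t s IH]; rewrite ?big_nil // big_cons /= Poly_addl IH. Qed.

Lemma Poly_Xnl n : Poly (Xnl n) = 'X^n.
Proof.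
elim: n => [|n IH] /=; first by rewrite cons_poly_def mul0r add0r.
by rewrite cons_poly_def IH addr0 exprSr.
Qed.

Lemma Poly_geoml k j : Poly (geoml k j) = geom Z k j.
Proof.
rewrite /geoml Poly_suml big_map -[k in iota 0 k]subn0 big_mkord.
by apply: eq_bigr => a _; apply: Poly_Xnl.
Qed.

Lemma Poly_pair_weightl k m : Poly (pair_weightl k m) = pair_weight Z k m.
Proof.
rewrite /pair_weightl Poly_suml big_map -[k in iota 0 k]subn0 big_mkord.
apply: eq_bigr => a _.
rewrite Poly_suml big_map -[X in iota 0 X]subn0 big_mkord.
apply: eq_bigr => b _; rewrite Poly_mull Poly_Xnl Poly_scalel Poly_geoml.
rewrite -mulrnAr -[in RHS]mulr_natl; congr (_ * (_ * _)).
by rewrite -polyC_natr; congr (_%:P); elim: (a - b)%N => // c IH; rewrite mulrS -IH; lia.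
Qed.

Lemma Poly_certl k m :
  Poly (certl k m.+1) =
  (1 - 'X + 'X^(m.+3)) * genparts Z k (off_pair m.+1) m.+2 * pair_weight Z k m.+1.
Proof.
rewrite /certl !Poly_mull Poly_addl Poly_Xnl Poly_pair_weightl mulrA.
congr (_ * _ * _).
  congr (_ + _); rewrite /= !cons_poly_def mul0r add0r.
  have -> : (Zneg xH)%:P = -1 :> {poly Z} by rewrite -polyCN.
  by rewrite mulN1r addrC.
rewrite genparts_below /genparts /index_iota subSS subn0 /=.
elim: (iota 1 m) => [|i s IH]; first by rewrite big_nil /= cons_poly_def mul0r add0r.
by rewrite big_cons /= Poly_mull Poly_geoml IH.
Qed.

(* From n = 3m + 5 on, positivity comes from the excess terms instead. *)
Definition cert_ok (k m : nat) : bool :=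
  all (Z.leb Z0) (drop (if k == 2 then 9 else 0) (certl k m)) &&
  all (fun n => Z.ltb Z0 (nth Z0 (certl k m) n)) (iota 17 (3 * m + 5 - 17)).

Lemma cert_ok_all :
  all (fun k => all (cert_ok k) (iota 1 9)) (iota 2 9).
Proof. by vm_compute. Qed.

(** * Positivity of single coefficients *)

Lemma nneg_coef (R : numDomainType) (p : {poly R}) i :
  p \is a polyOver nneg -> 0 <= p`_i.
Proof. by move=> /(nneg_coef_ge0 (n := i)); apply. Qed.

Lemma coefM_gt0 (R : numDomainType) (p q : {poly R}) i j :
  p \is a polyOver nneg -> q \is a polyOver nneg ->
  0 < p`_i -> 0 < q`_j -> 0 < (p * q)`_(i + j).
Proof.
move=> p0 q0 pi qj; have lt_i : (i < (i + j).+1)%N by rewrite ltnS leq_addr.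
rewrite coefM (bigD1 (Ordinal lt_i)) //= addKn ltr_pwDl ?mulr_gt0 //.
by apply: sumr_ge0 => l _; rewrite mulr_ge0 ?nneg_coef.
Qed.

Lemma coef_sum_gt0 (R : numDomainType) (I : eqType) (r : seq I)
    (F : I -> {poly R}) i n :
  i \in r -> (forall j, F j \is a polyOver nneg) -> 0 < (F i)`_n ->
  0 < (\sum_(j <- r) F j)`_n.
Proof.
move=> ir F0 Fi; rewrite (big_rem i) //= coefD ltr_pwDl // nneg_coef //.
exact: rpred_sum.
Qed.

Lemma coef_geom_gt0 (R : numDomainType) k j a :
  (a < k)%N -> 0 < (geom R k j)`_(a * j).
Proof.
move=> ak; apply: (coef_sum_gt0 (i := Ordinal ak)); rewrite ?mem_index_enum //.
  by move=> b; apply: polyOverXn.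
by rewrite coefXn eqxx.
Qed.

Lemma coef0_genparts_gt0 (R : numDomainType) k P n :
  (0 < k)%N -> 0 < (genparts R k P n)`_0.
Proof.
move=> k0; elim: n => [|n IH]; first by rewrite /genparts big_geq // coef1.
rewrite genpartsS; case: (P _); last by rewrite mulr1.
by apply: (@coefM_gt0 _ _ _ 0 0); rewrite ?genparts_nneg ?geom_nneg ?(@coef_geom_gt0 _ _ _ 0).
Qed.

Lemma coef_genparts_gt0 (R : numDomainType) k (P : pred nat) n p :
  (1 < k)%N -> (0 < p <= n)%N -> P p -> 0 < (genparts R k P n)`_p.
Proof.
move=> k1 pn Pp; rewrite (genpartsD1 _ _ pn) // -[p in _`_p]addn0.
apply: coefM_gt0; rewrite ?genparts_nneg ?geom_nneg ?coef0_genparts_gt0 ?(ltnW k1) //.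
by have := coef_geom_gt0 R p k1; rewrite mul1n.
Qed.

Lemma coef_pair_weight_gt0 (R : numDomainType) k m :
  (1 < k)%N -> 0 < (pair_weight R k m)`_m.
Proof.
move=> k1; have summand_nneg (a b : nat) :
    ('X^((a + b) * m + b) * geom R (a - b) 1) *+ (a - b) \is a polyOver nneg.
  by rewrite rpredMn ?rpredM ?polyOverXn ?geom_nneg.
apply: (coef_sum_gt0 (i := Ordinal k1)); rewrite ?mem_index_enum //=.
  by move=> a; apply: rpred_sum => b _.
(* The term a = 1, b = 0 of W is q^m. *)
rewrite big_ord1 /= ?addn0 mul1n ?addn0 subn0 mulr1n -[X in _`_X]addn0.
apply: coefM_gt0; rewrite ?polyOverXn ?geom_nneg ?coefXn ?eqxx //.
exact: (@coef_geom_gt0 _ _ _ 0).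
Qed.

(** For k >= 3 the term a = 2 gives q^(2j); for k = 2 that sum is empty and q^(2j+1) takes over. *)
Lemma coef_geom_excess_gt0 (R : numDomainType) k j :
  (1 < k)%N -> 0 < (geom_excess R k j)`_(2 * j + (k == 2)).
Proof.
move=> k1; rewrite /geom_excess coefD; case: eqP => [->|/eqP k2].
  by rewrite big_geq // coef0 add0r coefXn eqxx.
rewrite ltr_pwDl ?nneg_coef ?polyOverXn //.
apply: (coef_sum_gt0 (i := 2)); first by rewrite mem_index_iota; lia.
  by move=> a; apply: polyOverXn.
by rewrite /= addn0 coefXn eqxx.
Qed.

(** The extra q^(n+1) in [largest_part_sum] does not reach the coefficient of q^n. *)
Lemma coef_certl k m n :
  (1 < k)%N -> (0 < m < n)%N ->
  ((1 - 'X) * genparts Z k (off_pair m) n * pair_weight Z k m)`_n =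
  (certl k m)`_n +
  \sum_(m.+1 <= j < n)
    (genparts Z k (off_pair m) j * geom_excess Z k j.+1 * pair_weight Z k m)`_n.
Proof.
move=> k1; case: m => // m /= mn.
rewrite -(coef_Poly (certl k m.+1)) Poly_certl -coef_sum -mulr_suml -coefD -mulrDl.
by rewrite -largest_part_sum // [in RHS]mulrDl [in RHS]mulrDl coefD
  -(mulrA 'X^(n.+1)) coefXnM ltnSn addr0.
Qed.

Lemma certl_ge0 k m n :
  (1 < k <= 10)%N -> (0 < m < 10)%N -> (k = 2 -> 9 <= n)%N -> 0 <= (certl k m)`_n.
Proof.
move=> k10 m10 kn.
have /andP[/allP ge0 _] : cert_ok k m.
  by apply: (allP (allP cert_ok_all k _)); rewrite mem_iota; lia.
have [nz|nz] := leqP (size (certl k m)) n; first by rewrite nth_default.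
set d := if _ then _ else _ in ge0.
have dn : (d <= n)%N by rewrite /d; case: eqP => // /kn.
apply: (ge0 (certl k m)`_n); rewrite -[X in _`_X](subnKC dn) -nth_drop.
by rewrite mem_nth // size_drop ltn_sub2r // (leq_ltn_trans dn).
Qed.

Lemma certl_gt0 k m n :
  (1 < k <= 10)%N -> (0 < m < 10)%N -> (17 <= n < 3 * m + 5)%N ->
  0 < (certl k m)`_n.
Proof.
move=> k10 m10 n17.
have /andP[_ /allP gt0] : cert_ok k m.
  by apply: (allP (allP cert_ok_all k _)); rewrite mem_iota; lia.
have : n \in iota 17 (3 * m + 5 - 17) by rewrite mem_iota; lia.
by move/gt0.
Qed.

Lemma summand_ge0 k m n j :
  0 <= (genparts Z k (off_pair m) j * geom_excess Z k j.+1 * pair_weight Z k m)`_n.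
Proof.
by rewrite nneg_coef // !rpredM ?genparts_nneg ?geom_excess_nneg ?pair_weight_nneg.
Qed.

(** * Monotonicity in the part *)

Lemma mult_coef_le k m n :
  (1 < k <= 10)%N -> (0 < m)%N -> (k = 2 -> 9 <= n)%N ->
  mult_coef Z k n m.+1 <= mult_coef Z k n m.
Proof.
move=> k10 m0 kn; have /andP[k1 _] := k10.
have [nm|mn] := leqP n m; first by rewrite mult_coef_eq0 ?mult_coef_ge0.
rewrite -subr_ge0 mult_coefB ?m0 //.
have [m10|m10] := leqP 10 m.
  apply: (@coef_ge0M _ n) => //; first exact: genparts_off_pair_ge0.
  exact/nneg_coef_ge0/pair_weight_nneg.
rewrite coef_certl ?m0 // addr_ge0 ?certl_ge0 ?m0 // sumr_ge0 // => j _.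
exact: summand_ge0.
Qed.

Lemma mult_coef_lt k m n :
  (1 < k <= 10)%N -> (0 < m < 10)%N -> (17 <= n)%N ->
  mult_coef Z k n m.+1 < mult_coef Z k n m.
Proof.
move=> k10 m10 n17; have /andP[k1 _] := k10.
have mn : (0 < m < n)%N by lia.
rewrite -subr_gt0 mult_coefB // coef_certl //.
have [n3|n3] := ltnP n (3 * m + 5).
  rewrite ltr_pwDl ?certl_gt0 ?n17 // sumr_ge0 // => j _; exact: summand_ge0.
rewrite ltr_wpDl ?certl_ge0 //; first lia.
(* One positive excess term suffices. Degree [n] splits into [p] from [genparts], [2 * j.+1 + d]
   from the excess and [m] from W. The part [p] corrects parity: it is 0 or the odd [q], which is 1,
   or 3 when m = 1 since 1 and 2 are then left out. The bound n >= 3m + 5 yields m < j. *)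
pose d : nat := k == 2; pose q := ((m == 1%N) * 2).+1.
pose p := (odd (n - m - d) * q)%N.
pose j := ((n - m - d - p)./2).-1.
have [jm jn nE pj] : [/\ m < j, j < n, n = p + (2 * j.+1 + d) + m & p <= j]%N.
  by rewrite /j /p /q /d; split; lia.
rewrite (big_rem j) /= ?mem_index_iota ?jm //.
rewrite ltr_pwDl //; last by rewrite sumr_ge0 // => i _; exact: summand_ge0.
rewrite nE.
have exc0 := coef_geom_excess_gt0 Z j.+1 k1.
rewrite !coefM_gt0 ?rpredM ?genparts_nneg ?geom_excess_nneg ?pair_weight_nneg //.
  have [p0|p0] := posnP p; first by rewrite p0 coef0_genparts_gt0 // ltnW.
  by rewrite coef_genparts_gt0 // ?p0 //; move: p0; rewrite /p /q /off_pair; lia.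
exact: coef_pair_weight_gt0.
Qed.

Lemma mult_coef_antitone k i j n :
  (1 < k <= 10)%N -> (0 < i)%N -> (k = 2 -> 9 <= n)%N -> (i <= j)%N ->
  mult_coef Z k n j <= mult_coef Z k n i.
Proof.
move=> k10 i0 kn /subnKC <-; elim: (j - i)%N => [|d IH]; first by rewrite addn0.
by rewrite addnS (le_trans _ IH) // mult_coef_le // addn_gt0 i0.
Qed.

(** The index range does not depend on [r], so two residues can be compared term by term; terms
    beyond [n] vanish. *)
Lemma D_progression k r t n :
  (1 < k)%N -> (0 < r <= t)%N ->
  (D k r t n)%:R = \sum_(q < n.+1) mult_coef Z k n (r + q * t).
Proof.
case: k => // k _ /andP[r0 rt]; rewrite (D_mult_coef Z).
have t0 : (0 < t)%N by apply: leq_trans rt.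
rewrite -big_filter -[RHS](big_mkord xpredT (fun q => mult_coef Z k.+1 n (r + q * t))).
rewrite [RHS](bigID (fun q => r + q * t <= n)%N) /= [X in _ = _ + X]big1 ?addr0; last first.
  by move=> q; rewrite -ltnNge; apply: mult_coef_eq0.
rewrite -[RHS]big_filter -(big_map (fun q => (r + q * t)%N) xpredT (mult_coef Z k.+1 n)).
apply: perm_big; apply: uniq_perm => [||m].
- by rewrite filter_uniq ?iota_uniq.
- rewrite map_inj_uniq ?filter_uniq ?iota_uniq // => x y /addnI /eqP.
  by rewrite eqn_pmul2r // => /eqP.
rewrite mem_filter mem_index_iota; apply/idP/mapP => [|[q]]; last first.
  rewrite mem_filter mem_index_iota /= => /andP[qn _] ->.
  by rewrite addnC modnMDl eqxx addn_gt0 r0 orbT addnC.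
case/and3P=> mr m0 mn.
have le_rm : (r <= m)%N.
  (* The residue r = t is 0 modulo [t], which no [m] with 0 < m < t attains. *)
  rewrite leqNgt; apply: contraL mr => lt_mr; rewrite modn_small ?(leq_trans lt_mr) //.
  move: rt; rewrite leq_eqVlt => /predU1P[->|lt_rt]; first by rewrite modnn -lt0n.
  by rewrite modn_small // ltn_eqF.
have tq : (r + (m - r) %/ t * t = m)%N by rewrite divnK ?subnKC // -eqn_mod_dvd.
exists ((m - r) %/ t)%N => //; rewrite mem_filter mem_index_iota /= tq -ltnS mn /=.
by rewrite ltnS (leq_trans (leq_div _ _)) // (leq_trans (leq_subr _ _)).
Qed.

Local Close Scope ring_scope.

Theorem theorem1p3 (k t r s : nat) (hk : 2 <= k <= 10) (ht : 2 <= t <= 10)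
    (hr : 1 <= r) (hrs : r < s) (hst : s <= t) :
  ((3 <= k -> forall n : nat, 1 <= n -> D k s t n <= D k r t n) /\
   (k = 2 -> forall n : nat, 9 <= n -> D k s t n <= D k r t n)) /\
  (forall n : nat, 17 <= n -> D k s t n < D k r t n).
Proof.
have k1 : 1 < k by case/andP: hk.
have r_le_t : 0 < r <= t by rewrite hr ltnW // (leq_trans hrs).
have s_le_t : 0 < s <= t by rewrite hst andbT (leq_trans _ hrs).
have term_le n q : (k = 2 -> 9 <= n) ->
    (mult_coef Z k n (s + q * t) <= mult_coef Z k n (r + q * t))%R.
  by move=> kn; rewrite mult_coef_antitone ?leq_add2r ?addn_gt0 ?hr // ltnW.
have weak n : (k = 2 -> 9 <= n) -> D k s t n <= D k r t n.
  move=> kn; rewrite -(ler_nat Z) !D_progression //.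
  by apply: ler_sum => q _; apply: term_le.
split; first by split=> [k3|k2] n n0; apply: weak => // k2; rewrite k2 in k3.
move=> n n17; rewrite -(ltr_nat Z) !D_progression // !big_ord_recl.
have kn : k = 2 -> 9 <= n by move=> _; apply: leq_trans n17.
(* Strictness comes from q = 0 alone: E_s <= E_(r+1) < E_r, where r < s <= t <= 10 gives the r < 10
   required by [mult_coef_lt]. *)
apply: ltr_leD; last by apply: ler_sum => q _; apply: term_le.
rewrite /= !mul0n !addn0 (le_lt_trans (mult_coef_antitone hk _ kn hrs)) //.
by rewrite mult_coef_lt // hr; case/andP: ht => _; apply: leq_trans; apply: leq_trans hst.
Qed.
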